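(* Let $\mathcal{P}\in\mathcal{Q}_n$ be an irreducible, tridiagonal sign pattern with a $0$-diagonal, where $n\le 5$. Then $\mathcal{P}$ is consistent if and only if $\mathcal{P}$ requires a unique inertia.
   Context: A sign pattern is a matrix with entries in $\{+,-,0\}$; $\mathcal{Q}_n$ is the set of $n\times n$ sign patterns. The qualitative class $\mathcal{Q}(\mathcal{P})$ of $\mathcal{P}=[p_{ij}]$ is the set of real $n\times n$ matrices $A=[a_{ij}]$ with $\mathrm{sgn}(a_{ij})=p_{ij}$ for all $i,j$. $\mathcal{P}$ is tridiagonal if $p_{ij}=0$ whenever $|i-j|>1$; an irreducible tridiagonal pattern has $p_{i,i+1}\neq 0$ and $p_{i+1,i}\neq 0$ for all $i$; ''$0$-diagonal'' means $p_{ii}=0$ for all $i$. $\mathcal{P}$ is $k$-consistent if every $A\in\mathcal{Q}(\mathcal{P})$ has exactly $k$ real eigenvalues (counted with algebraic multiplicity), and consistent if it is $k$-consistent for some $k$. The inertia of a real matrix $A$ is $(i_+(A),i_-(A),i_0(A))$, the numbers of eigenvalues with positive, negative and zero real part; $\mathcal{P}$ requires a unique inertia if all $A\in\mathcal{Q}(\mathcal{P})$ have the same inertia. *)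

(* Defs.v *)
From mathcomp Require Import all_boot all_order all_fingroup all_algebra.
From mathcomp Require Import reals.
From mathcomp Require Import complex.

Set Implicit Arguments.
Unset Strict Implicit.
Unset Printing Implicit Defensive.

Import Order.TTheory GRing.Theory Num.Theory.
Local Open Scope ring_scope.

Inductive sign : Type := Plus | Minus | Zero.

Definition sgn (R : realType) (x : R) : sign :=
  if 0 < x then Plus else if x < 0 then Minus else Zero.

Definition sign_pattern (n : nat) : Type := 'M[sign]_n.

Section Patterns.
Variable n : nat.
Implicit Type P : sign_pattern n.

Definition tridiagonal P : Prop :=
  forall i j : 'I_n, (1 < `|i - j|)%N -> P i j = Zero.

Definition zero_diagonal P : Prop := forall i : 'I_n, P i i = Zero.

(* A simultaneous permutation of rows and columns yields a zero lower-left
   block, the diagonal blocks having sizes k and n - k with 0 < k < n.  In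
   particular every 1 x 1 pattern, including [0], is irreducible. *)
Definition reducible P : Prop :=
  exists (s : 'S_n) (k : nat), (0 < k < n)%N /\
    forall i j : 'I_n, (k <= i)%N -> (j < k)%N -> P (s i) (s j) = Zero.

Definition irreducible P : Prop := ~ reducible P.

End Patterns.

Section Spectrum.
Variables (R : realType) (n : nat).
Implicit Type A : 'M[R]_n.

(* The complex roots of the characteristic polynomial, each repeated according
   to its algebraic multiplicity (in an unspecified order). *)
Definition eigenvalues A : seq R[i] :=
  sval (closed_field_poly_normal (char_poly (map_mx (real_complex R) A))).

Definition num_real_eigenvalues A : nat :=
  count (fun z : R[i] => complex.Im z == 0) (eigenvalues A).

Definition inertia A : nat * nat * nat :=
  (count (fun z : R[i] => 0 < complex.Re z) (eigenvalues A),
   count (fun z : R[i] => complex.Re z < 0) (eigenvalues A),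
   count (fun z : R[i] => complex.Re z == 0) (eigenvalues A)).

End Spectrum.

Definition qualitative_class (R : realType) (n : nat) (P : sign_pattern n)
    (A : 'M[R]_n) : Prop :=
  forall i j : 'I_n, sgn (A i j) = P i j.

Definition k_consistent (R : realType) (n k : nat) (P : sign_pattern n) : Prop :=
  forall A : 'M[R]_n, qualitative_class P A -> num_real_eigenvalues A = k.

Definition consistent (R : realType) (n : nat) (P : sign_pattern n) : Prop :=
  exists k : nat, k_consistent R k P.

Definition requires_unique_inertia (R : realType) (n : nat)
    (P : sign_pattern n) : Prop :=
  forall A B : 'M[R]_n,
    qualitative_class P A -> qualitative_class P B -> inertia A = inertia B.

(* Main.v *)
Require Import Defs.
From mathcomp Require Import all_boot all_order all_fingroup all_algebra.
From mathcomp Require Import reals.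
From mathcomp Require Import complex ring lra zify.

(** The products [p_k] of the opposite entries [(k, k+1)] and [(k+1, k)]
    determine the characteristic polynomial through the continuant recurrence.
    For [n <= 5] it is [X^(n mod 2)] times [1], [X^2 - y] or [X^4 - s X^2 + t],
    with [t = p0 p2] for [n = 4] and [t = p0 p2 + p0 p3 + p1 p3] for [n = 5].  If
    it splits into [X^(n mod 2)] and factors [X^2 - y] with [y] real and nonzero,
    then the number of real eigenvalues and the inertia are both determined by
    the number [c] of positive [y], and each of them determines [c].  For every
    choice of signs of the [p_k], either all matrices of the class split in this
    way with the same [c], or two of them split with different values of [c]; in
    the first case both properties of the pattern hold, in the second both
    fail. *)

Set Implicit Arguments.
Unset Strict Implicit.
Unset Printing Implicit Defensive.

Import Order.TTheory GRing.Theory Num.Theory.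
Local Open Scope ring_scope.

(** * Eigenvalues of a product of factors [X^2 - y] with [y] real *)

Section Spectrum.
Variable R : realType.

(** Since [0] is not in [l], the root zero has multiplicity exactly [odd n], and each [y]
    contributes two opposite nonzero roots, both real or both purely imaginary. *)
Definition rooted_in_squares (q : {poly R}) (n c : nat) : Prop :=
  exists l : seq R,
    [/\ size l = n./2, 0 \notin l, count (fun y : R => 0 < y)%R l = c
      & q = 'X^(odd n) * \prod_(y <- l) ('X^2 - y%:P)].

Definition root_of (y : R) : R[i] :=
  if 0 < y then Complex (Num.sqrt y) 0 else Complex 0 (Num.sqrt (- y)).

Lemma sqr_root_of (y : R) : root_of y ^+ 2 = real_complex R y.
Proof.
rewrite /root_of; case: ifP => y0; rewrite expr2; simpc; congr Complex.
- by rewrite -expr2 sqr_sqrtr // ltW.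
- by rewrite -expr2 sqr_sqrtr ?opprK // oppr_ge0 leNgt y0.
Qed.

Definition roots_of (e : nat) (l : seq R) : seq R[i] :=
  nseq e 0 ++ flatten [seq [:: root_of y; - root_of y] | y <- l].

Lemma prod_roots_of (e : nat) (l : seq R) :
  map_poly (real_complex R) ('X^e * \prod_(y <- l) ('X^2 - y%:P)) =
  \prod_(z <- roots_of e l) ('X - z%:P).
Proof.
rewrite rmorphM /= map_polyXn big_cat /=; congr (_ * _).
  elim: e => [|e IH]; first by rewrite big_nil expr0.
  by rewrite /= big_cons subr0 exprS IH.
elim: l => [|y l IH]; first by rewrite !big_nil rmorph1.
rewrite big_cons rmorphM /= !big_cons IH mulrA; congr (_ * _).
rewrite rmorphB /= map_polyXn map_polyC /= -sqr_root_of rmorphXn /= polyCN.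
by ring.
Qed.

(** A monic polynomial determines its linear factors up to order, and order is irrelevant for
    counting. *)
Lemma perm_eigenvalues (n e : nat) (A : 'M[R]_n) (l : seq R) :
  char_poly A = 'X^e * \prod_(y <- l) ('X^2 - y%:P) ->
  perm_eq (eigenvalues A) (roots_of e l).
Proof.
move=> eqA; apply: prod_XsubC_eq; rewrite -prod_roots_of -eqA.
rewrite /eigenvalues; case: closed_field_poly_normal => r /= eq_r.
by rewrite map_char_poly [RHS]eq_r (monicP (char_poly_monic _)) scale1r.
Qed.

Lemma count_roots_of (a : pred R[i]) (e : nat) (l : seq R) :
  count a (roots_of e l) =
  (a 0%R * e + \sum_(y <- l) (a (root_of y) + a (- root_of y)))%N.
Proof.
rewrite count_cat count_nseq; congr (_ + _)%N.
elim: l => [|y l IH]; first by rewrite big_nil.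
by rewrite big_cons /= IH addnA.
Qed.

(** A positive [y] gives one positive and one negative real root, a negative [y] two purely
    imaginary ones; the root zero for odd [n] is real with zero real part. *)
Lemma spectrum_of_squares (n c : nat) (A : 'M[R]_n) :
  rooted_in_squares (char_poly A) n c ->
  num_real_eigenvalues A = (odd n + c.*2)%N /\
  inertia A = (c, c, odd n + (n./2 - c).*2)%N.
Proof.
case=> l [szl nz0 <- /perm_eigenvalues perm_l].
(* [u] and [v] count how many of [root_of y] and [- root_of y] satisfy [a], for positive and for
   negative [y]. *)
have sum_l (a : pred R[i]) (u v : nat) :
    (forall y : R, 0 < y -> (a (root_of y) + a (- root_of y) = u)%N) ->
    (forall y : R, y < 0 -> (a (root_of y) + a (- root_of y) = v)%N) ->
  count a (eigenvalues A) = (a 0%R * odd n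
    + (u * count (fun y : R => 0 < y)%R l
       + v * (n./2 - count (fun y : R => 0 < y)%R l)))%N.
  move=> au av; rewrite (seq.permP perm_l) count_roots_of; congr (_ + _)%N.
  rewrite -szl; elim: l nz0 {szl perm_l} => [|y l IH]; first by rewrite big_nil !muln0.
  rewrite inE negb_or => /andP[y0 l0]; rewrite big_cons IH //=.
  have := count_size (fun y : R => 0 < y) l.
  case: (ltrgt0P y) => yy; last by rewrite yy eqxx in y0.
    by rewrite au //; nia.
  by rewrite av //; nia.
rewrite /num_real_eigenvalues /inertia.
have pos (y : R) : 0 < y -> exists2 r, 0 < r & root_of y = Complex r 0.
  by move=> y0; exists (Num.sqrt y); rewrite ?sqrtr_gt0 // /root_of y0.
have neg (y : R) : y < 0 -> exists2 r, 0 < r & root_of y = Complex 0 r.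
  move=> y0; exists (Num.sqrt (- y)); first by rewrite sqrtr_gt0 oppr_gt0.
  by rewrite /root_of ltNge ltW.
rewrite (sum_l _ 2 0) ?(sum_l (fun z => 0 < complex.Re z) 1 0)
  ?(sum_l (fun z => complex.Re z < 0) 1 0) ?(sum_l (fun z => complex.Re z == 0) 0 2)
  /= ?eqxx ?ltxx; first by split; [lia|congr (_,_,_); lia].
all: move=> y; (move=> /pos[r r0 ->] || move=> /neg[r r0 ->]).
all: by rewrite /= ?oppr_eq0 ?oppr_lt0 ?oppr_gt0 ?eqxx ?ltxx
  ?(gt_eqF r0) ?r0 ?(lt_gtF r0).
Qed.

(** * Characteristic polynomials of tridiagonal matrices *)

(** Expand along the first row, then the second minor along its first column. Indexing by natural
    numbers makes the remaining minors shifts of [a]. *)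
Lemma det_tridiagonal (T : comPzRingType) (n : nat) (a : nat -> nat -> T) :
  (forall i j, (i.+1 < j)%N || (j.+1 < i)%N -> a i j = 0) ->
  \det (\matrix_(i < n.+2, j < n.+2) a i j) =
    a 0 0 * \det (\matrix_(i < n.+1, j < n.+1) a i.+1 j.+1)
    - a 0 1 * a 1 0 * \det (\matrix_(i < n, j < n) a i.+2 j.+2).
Proof.
move=> a0; rewrite (expand_det_row _ ord0) 2!big_ord_recl big1; last first.
  by move=> i _; rewrite mxE a0 ?mul0r.
rewrite addr0 /cofactor !mxE /= expr0 mul1r expr1.
congr (_ * \det _ + _).
  by apply/matrixP => i j; rewrite !mxE.
rewrite (expand_det_col _ ord0) big_ord_recl big1; last first.
  by move=> i _; rewrite !mxE a0 ?mul0r.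
rewrite addr0 /cofactor !mxE /= expr0 mul1r mulN1r mulrN mulrA.
congr (- (_ * \det _)).
by apply/matrixP => i j; rewrite !mxE.
Qed.

(* [p k] stands for the product of the entries (k, k+1) and (k+1, k)
  of a tridiagonal matrix with zero diagonal. *)
Fixpoint continuant (n : nat) (p : nat -> R) : {poly R} :=
  if n is n1.+1 then
    if n1 is n2.+1 then
      'X * continuant n1 (fun k => p k.+1)
      - (p 0)%:P * continuant n2 (fun k => p k.+2)
    else 'X
  else 1.

Lemma char_poly_continuant (n : nat) (a : nat -> nat -> R) :
  (forall i j, j != i.+1 -> i != j.+1 -> a i j = 0) ->
  char_poly (\matrix_(i < n, j < n) a i j) =
  continuant n (fun k => a k k.+1 * a k.+1 k).
Proof.
pose c (a : nat -> nat -> R) i j : {poly R} := 'X *+ (i == j) - (a i j)%:P.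
have charE m (b : nat -> nat -> R) : char_poly (\matrix_(i < m, j < m) b i j) =
    \det (\matrix_(i < m, j < m) c b i j).
  by rewrite /char_poly; congr (\det _); apply/matrixP => i j; rewrite !mxE.
(* The recurrence goes down by two sizes, hence the induction on a bound of [n]. *)
have [m] := ubnP n; elim: m n a => // m IH [|[|n]] a lt_nm a0.
- by rewrite charE det_mx00.
- by rewrite charE det_mx11 !mxE /c /= a0 ?subr0.
rewrite charE det_tridiagonal; last first.
  move=> i j ij; rewrite /c a0; try lia.
  have -> : (i == j) = false by lia.
  by rewrite subr0.
have -> k : \det (\matrix_(i < k, j < k) c a i.+1 j.+1) =
    char_poly (\matrix_(i < k, j < k) a i.+1 j.+1).
  by rewrite (charE k (fun i j => a i.+1 j.+1)).
have -> k : \det (\matrix_(i < k, j < k) c a i.+2 j.+2) =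
    char_poly (\matrix_(i < k, j < k) a i.+2 j.+2).
  by rewrite (charE k (fun i j => a i.+2 j.+2)).
rewrite (IH _ (fun i j => a i.+1 j.+1)) ?(IH _ (fun i j => a i.+2 j.+2)) //; try lia.
all: try by move=> i j *; apply: a0.
by rewrite /c /= a0 // !subr0 !sub0r mulrNN -polyCM.
Qed.

Definition edge (n : nat) (A : 'M[R]_n.+1) (k : nat) : R :=
  A (inord k) (inord k.+1) * A (inord k.+1) (inord k).

Lemma continuantSS (n : nat) (p : nat -> R) :
  continuant n.+2 p = 'X * continuant n.+1 (fun k => p k.+1)
    - (p 0)%:P * continuant n (fun k => p k.+2).
Proof. by []. Qed.

(** Only the first [n.-1] values of [p] are read, so the values of [edge] beyond the matrix, where
    [inord] falls back to index 0, are harmless. *)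
Lemma eq_continuant (n : nat) (p q : nat -> R) :
  (forall k, (k.+1 < n)%N -> p k = q k) -> continuant n p = continuant n q.
Proof.
have [m] := ubnP n; elim: m n p q => // m IH [|[|n]] p q // lt_nm pq.
rewrite !continuantSS pq // (IH n.+1 _ (fun k => q k.+1)) //; try lia.
  by rewrite (IH n _ (fun k => q k.+2)) // => [|k lt_kn]; [lia|apply: pq; lia].
by move=> k lt_kn; apply: pq; lia.
Qed.

Lemma char_poly_tridiagonal (n : nat) (A : 'M[R]_n.+1) :
  (forall i j : 'I_n.+1, j != i.+1 :> nat -> i != j.+1 :> nat -> A i j = 0) ->
  char_poly A = continuant n.+1 (edge A).
Proof.
move=> A0.
(* The boolean multiplier forces zeros off the two adjacent diagonals at all natural indices, also
   those out of range, where [inord] returns 0. *)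
pose a (i j : nat) := A (inord i) (inord j) *+ ((j == i.+1) || (i == j.+1)).
have -> : char_poly A = char_poly (\matrix_(i < n.+1, j < n.+1) a i j).
  congr char_poly; apply/matrixP => i j; rewrite mxE /a !inord_val.
  by case: eqVneq => //= ij; case: eqVneq => //= ji; rewrite A0.
rewrite char_poly_continuant; last by move=> i j /negPf ij /negPf ji; rewrite /a ij ji.
by apply: eq_continuant => k _; rewrite /a !eqxx orbT.
Qed.

(** * Continuants of size 2 to 5 and their roots in [X^2] *)

Lemma continuant2 p : continuant 2 p = 'X^2 - (p 0)%:P.
Proof. by rewrite /= mulr1. Qed.

Lemma continuant3 p : continuant 3 p = 'X^(odd 3) * ('X^2 - (p 0 + p 1)%:P).
Proof. by rewrite /= polyCD; ring. Qed.

Definition biquadratic (s t : R) : {poly R} := 'X^4 - s%:P * 'X^2 + t%:P.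

Lemma continuant4 p :
  continuant 4 p = 'X^(odd 4) * biquadratic (p 0 + p 1 + p 2) (p 0 * p 2).
Proof. by rewrite /biquadratic /= !polyCD !polyCM; ring. Qed.

Lemma continuant5 p :
  continuant 5 p = 'X^(odd 5) * biquadratic (p 0 + p 1 + p 2 + p 3)
                          (p 0 * p 2 + p 0 * p 3 + p 1 * p 3).
Proof. by rewrite /biquadratic /= !polyCD !polyCM; ring. Qed.

(** By the quadratic formula in [X^2] both [y] are real, with sum [s] and product [t]. They have
    opposite signs if [t < 0]; otherwise both have the sign of [s]. *)
Lemma biquadratic_rooted (n : nat) (s t : R) (c : nat) :
  n./2 = 2 -> t != 0 -> 4 * t <= s ^+ 2 ->
  c = (if t < 0 then 1%N else if 0 < s then 2%N else 0%N) ->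
  rooted_in_squares ('X^(odd n) * biquadratic s t) n c.
Proof.
move=> n2 t0 disc ->.
pose d := Num.sqrt (s ^+ 2 - 4 * t).
have d2 : d ^+ 2 = s ^+ 2 - 4 * t by rewrite sqr_sqrtr // subr_ge0.
have d0 : 0 <= d by apply: sqrtr_ge0.
pose y1 := (s + d) / 2; pose y2 := (s - d) / 2.
have sumE : s = y1 + y2 by rewrite /y1 /y2; field.
have prodE : t = y1 * y2.
  by apply: (@mulfI _ 4); rewrite ?pnatr_eq0 // /y1 /y2; field: d2.
have le_y : y2 <= y1 by rewrite /y1 /y2; lra.
clearbody y1 y2; exists [:: y1; y2]; split => //.
- by move: t0; rewrite prodE mulf_eq0 !inE !(eq_sym 0).
- rewrite prodE in t0; rewrite /= addn0 sumE prodE.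
  clear n2 sumE prodE disc d2 d0.
  case/orP: (lt_total t0) => t_sg; rewrite ?t_sg ?(lt_gtF t_sg).
    by case: (ltP 0 y1) => ?; case: (ltP 0 y2) => //= ?; exfalso; nra.
  case: (ltP 0 (y1 + y2)) => ?; case: (ltP 0 y1) => ?;
    by case: (ltP 0 y2) => //= ?; exfalso; nra.
- rewrite 2!big_cons big_nil /biquadratic sumE prodE polyCD polyCM.
  by congr (_ * _); ring.
Qed.

Lemma rooted_opposite (n : nat) (s t : R) :
  n./2 = 2 -> t < 0 -> rooted_in_squares ('X^(odd n) * biquadratic s t) n 1.
Proof.
move=> n2 t0; apply: biquadratic_rooted => //; first by rewrite lt_eqF.
  by have := sqr_ge0 s; lra.
by rewrite t0.
Qed.

Lemma rooted_positive (n : nat) (s t : R) :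
  n./2 = 2 -> 0 < t -> 0 < s -> 4 * t <= s ^+ 2 ->
  rooted_in_squares ('X^(odd n) * biquadratic s t) n 2.
Proof.
move=> n2 t0 s0 disc; apply: biquadratic_rooted => //; first by rewrite gt_eqF.
by rewrite (lt_gtF t0) s0.
Qed.

Lemma rooted_negative (n : nat) (s t : R) :
  n./2 = 2 -> 0 < t -> s < 0 -> 4 * t <= s ^+ 2 ->
  rooted_in_squares ('X^(odd n) * biquadratic s t) n 0.
Proof.
move=> n2 t0 s0 disc; apply: biquadratic_rooted => //; first by rewrite gt_eqF.
by rewrite (lt_gtF t0) (lt_gtF s0).
Qed.

(** * Sign choices for the products: constant or varying number of positive [y] *)

Definition signed (s : nat -> bool) (m : nat) (p : nat -> R) : Prop :=
  forall k, (k < m)%N -> if s k then 0 < p k else p k < 0.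

Definition constant_spectrum (n : nat) (s : nat -> bool) : Prop :=
  exists c, forall p, signed s n.-1 p -> rooted_in_squares (continuant n p) n c.

(** Only the two witnesses are required to split; for other [p] with these signs the roots in [X^2]
    may be non-real. *)
Definition varying_spectrum (n : nat) (s : nat -> bool) : Prop :=
  exists p p' c c',
    [/\ signed s n.-1 p, signed s n.-1 p',
        rooted_in_squares (continuant n p) n c,
        rooted_in_squares (continuant n p') n c' & c <> c'].

Lemma linear_rooted (n : nat) (y : R) :
  n./2 = 1 -> y != 0 -> rooted_in_squares ('X^(odd n) * ('X^2 - y%:P)) n (0 < y)%R.
Proof.
move=> n2 y0; exists [:: y]; rewrite big_seq1 /= addn0; split => //.
by rewrite inE eq_sym.
Qed.

Lemma varying_spectrum_intro (n : nat) (s : nat -> bool) (l l' : seq R) (c c' : nat) :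
  c <> c' -> signed s n.-1 (nth 0 l) -> signed s n.-1 (nth 0 l') ->
  rooted_in_squares (continuant n (nth 0 l)) n c ->
  rooted_in_squares (continuant n (nth 0 l')) n c' ->
  varying_spectrum n s.
Proof. by move=> cc' *; exists (nth 0 l), (nth 0 l'), c, c'. Qed.

Lemma constant_spectrum2 (s : nat -> bool) : constant_spectrum 2 s.
Proof.
(* The boolean is read as the number 1 or 0: the only [y] is [p 0]. *)
exists (s 0) => p /(_ 0 isT) p0.
have -> : s 0 = (0 < p 0) by case: (s 0) p0 => [->//|/lt_gtF->].
rewrite continuant2 -[_ - _]mul1r; apply: (@linear_rooted 2) => //.
by case: (s 0) p0 => p0; rewrite ?(gt_eqF p0) ?(lt_eqF p0).
Qed.

(** The only [y] is [p 0 + p 1], whose sign is forced exactly when both summands have the same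
    sign. *)
Lemma dichotomy3 (s : nat -> bool) : constant_spectrum 3 s \/ varying_spectrum 3 s.
Proof.
have rooted_pos p : 0 < p 0 + p 1 -> rooted_in_squares (continuant 3 p) 3 1.
  move=> p0; have := @linear_rooted 3 (p 0 + p 1) erefl.
  by rewrite p0 continuant3; apply; rewrite gt_eqF.
have rooted_neg p : p 0 + p 1 < 0 -> rooted_in_squares (continuant 3 p) 3 0.
  move=> p0; have := @linear_rooted 3 (p 0 + p 1) erefl.
  by rewrite (lt_gtF p0) continuant3; apply; rewrite lt_eqF.
case s0: (s 0); case s1: (s 1).
- left; exists 1 => p sp; have := sp 0 isT; have := sp 1 isT; rewrite s0 s1 => *.
  by apply: rooted_pos; lra.
- right; apply: (@varying_spectrum_intro _ _ [:: 2; -1] [:: 1; -2] 1 0) => //.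
  + by case=> [|[|k]] //= _; rewrite ?s0 ?s1; lra.
  + by case=> [|[|k]] //= _; rewrite ?s0 ?s1; lra.
  + by apply: rooted_pos => /=; lra.
  + by apply: rooted_neg => /=; lra.
- right; apply: (@varying_spectrum_intro _ _ [:: -1; 2] [:: -2; 1] 1 0) => //.
  + by case=> [|[|k]] //= _; rewrite ?s0 ?s1; lra.
  + by case=> [|[|k]] //= _; rewrite ?s0 ?s1; lra.
  + by apply: rooted_pos => /=; lra.
  + by apply: rooted_neg => /=; lra.
- left; exists 0 => p sp; have := sp 0 isT; have := sp 1 isT; rewrite s0 s1 => *.
  by apply: rooted_neg; lra.
Qed.

(** If [p 0] and [p 2] have opposite signs, then [t < 0] and [c = 1]. If they agree, then [t > 0]
    and the sign of the sum decides: it is fixed when [p 1] agrees too, and can be either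
    otherwise. *)
Lemma dichotomy4 (s : nat -> bool) : constant_spectrum 4 s \/ varying_spectrum 4 s.
Proof.
have sg4 p : signed s 3 p ->
    [/\ if s 0 then 0 < p 0 else p 0 < 0, if s 1 then 0 < p 1 else p 1 < 0
      & if s 2 then 0 < p 2 else p 2 < 0] by move=> sp; split; apply: sp.
(* The difference is [(a + b - c)^2 + 4 b c]. *)
have disc (a b c : R) : 0 < b * c -> 4 * (a * c) <= (a + b + c) ^+ 2.
  by move=> bc; have := sqr_ge0 (a + b - c); nra.
case s0: (s 0); case s1: (s 1); case s2: (s 2).
- left; exists 2 => p /sg4; rewrite s0 s1 s2 => -[? ? ?]; rewrite continuant4.
  by apply: rooted_positive => //; [nra|lra|apply: disc; nra].
- left; exists 1 => p /sg4; rewrite s0 s1 s2 => -[? ? ?]; rewrite continuant4.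
  by apply: rooted_opposite => //; nra.
(* The sums are 4 and -3 with [t] equal to 4 and 1, so [4 * t <= s ^+ 2] holds for both. *)
- right; apply: (@varying_spectrum_intro _ _ [:: 4; -1; 1] [:: 1; -5; 1] 2 0) => //.
  + by case=> [|[|[|k]]] //= _; rewrite ?s0 ?s1 ?s2; lra.
  + by case=> [|[|[|k]]] //= _; rewrite ?s0 ?s1 ?s2; lra.
  + by rewrite continuant4; apply: rooted_positive => //=; lra.
  + by rewrite continuant4; apply: rooted_negative => //=; lra.
- left; exists 1 => p /sg4; rewrite s0 s1 s2 => -[? ? ?]; rewrite continuant4.
  by apply: rooted_opposite => //; nra.
- left; exists 1 => p /sg4; rewrite s0 s1 s2 => -[? ? ?]; rewrite continuant4.
  by apply: rooted_opposite => //; nra.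
- right; apply: (@varying_spectrum_intro _ _ [:: -1; 5; -1] [:: -4; 1; -1] 2 0) => //.
  + by case=> [|[|[|k]]] //= _; rewrite ?s0 ?s1 ?s2; lra.
  + by case=> [|[|[|k]]] //= _; rewrite ?s0 ?s1 ?s2; lra.
  + by rewrite continuant4; apply: rooted_positive => //=; lra.
  + by rewrite continuant4; apply: rooted_negative => //=; lra.
- left; exists 1 => p /sg4; rewrite s0 s1 s2 => -[? ? ?]; rewrite continuant4.
  by apply: rooted_opposite => //; nra.
- left; exists 0 => p /sg4; rewrite s0 s1 s2 => -[? ? ?]; rewrite continuant4.
  by apply: rooted_negative => //; [nra|lra|apply: disc; nra].
Qed.

(** The first list has [t < 0], hence [c = 1]; the second has [t > 0], hence [c] is 0 or 2. Either
    differs from 1, so the sign of the second sum is left open. *)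
Lemma varying5 (s : nat -> bool) (a b c d a' b' c' d' : R) :
  (if s 0 then 0 < a else a < 0) -> (if s 1 then 0 < b else b < 0) ->
  (if s 2 then 0 < c else c < 0) -> (if s 3 then 0 < d else d < 0) ->
  (if s 0 then 0 < a' else a' < 0) -> (if s 1 then 0 < b' else b' < 0) ->
  (if s 2 then 0 < c' else c' < 0) -> (if s 3 then 0 < d' else d' < 0) ->
  a * c + a * d + b * d < 0 -> 0 < a' * c' + a' * d' + b' * d' ->
  4 * (a' * c' + a' * d' + b' * d') <= (a' + b' + c' + d') ^+ 2 ->
  varying_spectrum 5 s.
Proof.
move=> sa sb sc sd sa' sb' sc' sd' t_lt0 t'_gt0 disc.
have sgn_l : signed s 4 (nth 0 [:: a; b; c; d]) by case=> [|[|[|[|k]]]].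
have sgn_l' : signed s 4 (nth 0 [:: a'; b'; c'; d']) by case=> [|[|[|[|k]]]].
have opp : rooted_in_squares (continuant 5 (nth 0 [:: a; b; c; d])) 5 1.
  by rewrite continuant5; apply: rooted_opposite.
case: (ltrgt0P (a' + b' + c' + d')) => s'; last by rewrite s' in disc; lra.
- apply: (@varying_spectrum_intro 5 s _ _ 1 2 _ sgn_l sgn_l' opp) => //.
  by rewrite continuant5; apply: rooted_positive.
- apply: (@varying_spectrum_intro 5 s _ _ 1 0 _ sgn_l sgn_l' opp) => //.
  by rewrite continuant5; apply: rooted_negative.
Qed.

(** The three products in [t] are all positive only when all signs agree, and all negative only for
    [++--] and [--++]. In the other twelve cases terms of both signs compete, and suitable
    magnitudes make [t] negative or positive. *)
Lemma dichotomy5 (s : nat -> bool) : constant_spectrum 5 s \/ varying_spectrum 5 s.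
Proof.
have sg5 p : signed s 4 p ->
    [/\ if s 0 then 0 < p 0 else p 0 < 0, if s 1 then 0 < p 1 else p 1 < 0,
        if s 2 then 0 < p 2 else p 2 < 0 & if s 3 then 0 < p 3 else p 3 < 0]
  by move=> sp; split; apply: sp.
(* The difference is [(a + b - c - d)^2 + 4 b c]. *)
have disc (a b c d : R) : 0 < b * c ->
    4 * (a * c + a * d + b * d) <= (a + b + c + d) ^+ 2.
  by move=> bc; have := sqr_ge0 (a + b - c - d); nra.
case s0: (s 0); case s1: (s 1); case s2: (s 2); case s3: (s 3).
- left; exists 2 => p /sg5; rewrite s0 s1 s2 s3 => -[? ? ? ?]; rewrite continuant5.
  by apply: rooted_positive => //; [nra|lra|apply: disc; nra].
- right; apply: (@varying5 s 1 1 1 (-1) 4 4 4 (-1));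
    rewrite ?s0 ?s1 ?s2 ?s3; lra.
- right; apply: (@varying5 s 1 1 (-3) 1 1 1 (-1) 1);
    rewrite ?s0 ?s1 ?s2 ?s3; lra.
- left; exists 1 => p /sg5; rewrite s0 s1 s2 s3 => -[? ? ? ?]; rewrite continuant5.
  by apply: rooted_opposite => //; nra.
- right; apply: (@varying5 s 1 (-3) 1 1 1 (-1) 1 1);
    rewrite ?s0 ?s1 ?s2 ?s3; lra.
- right; apply: (@varying5 s 4 (-1) 1 (-2) 8 (-1) 1 (-1));
    rewrite ?s0 ?s1 ?s2 ?s3; lra.
- right; apply: (@varying5 s 1 (-1) (-1) 1 4 (-1) (-1) 4);
    rewrite ?s0 ?s1 ?s2 ?s3; lra.
- right; apply: (@varying5 s 1 (-1) (-1) (-1) 1 (-4) (-4) (-4));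
    rewrite ?s0 ?s1 ?s2 ?s3; lra.
(* From here on the witnesses are earlier ones negated, which preserves [t] and the square of the
   sum. *)
- right; apply: (@varying5 s (-1) 1 1 1 (-1) 4 4 4);
    rewrite ?s0 ?s1 ?s2 ?s3; lra.
- right; apply: (@varying5 s (-1) 1 1 (-1) (-4) 1 1 (-4));
    rewrite ?s0 ?s1 ?s2 ?s3; lra.
- right; apply: (@varying5 s (-4) 1 (-1) 2 (-8) 1 (-1) 1);
    rewrite ?s0 ?s1 ?s2 ?s3; lra.
- right; apply: (@varying5 s (-1) 3 (-1) (-1) (-1) 1 (-1) (-1));
    rewrite ?s0 ?s1 ?s2 ?s3; lra.
- left; exists 1 => p /sg5; rewrite s0 s1 s2 s3 => -[? ? ? ?]; rewrite continuant5.
  by apply: rooted_opposite => //; nra.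
- right; apply: (@varying5 s (-1) (-1) 3 (-1) (-1) (-1) 1 (-1));
    rewrite ?s0 ?s1 ?s2 ?s3; lra.
- right; apply: (@varying5 s (-1) (-1) (-1) 1 (-4) (-4) (-4) 1);
    rewrite ?s0 ?s1 ?s2 ?s3; lra.
- left; exists 0 => p /sg5; rewrite s0 s1 s2 s3 => -[? ? ? ?]; rewrite continuant5.
  by apply: rooted_negative => //; [nra|lra|apply: disc; nra].
Qed.

Lemma spectrum_dichotomy (n : nat) (s : nat -> bool) :
  (0 < n <= 5)%N -> constant_spectrum n s \/ varying_spectrum n s.
Proof.
case: n => [|[|[|[|[|[|n]]]]]] // _.
- by left; exists 0%N => p _; exists [::]; rewrite big_nil mulr1; split.
- by left; apply: constant_spectrum2.
- exact: dichotomy3.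
- exact: dichotomy4.
- exact: dichotomy5.
Qed.

(** * From sign patterns to signs of the products *)

Definition sign_val (x : sign) : R :=
  match x with Plus => 1 | Minus => -1 | Zero => 0 end.

Lemma sgn_sign_val (x : sign) (w : R) : 0 < w -> sgn (sign_val x * w) = x.
Proof.
move=> w0; rewrite /sgn; case: x => /=; rewrite ?mul1r ?mulN1r ?mul0r ?w0 ?ltxx //.
by rewrite oppr_gt0 oppr_lt0 w0 lt_gtF.
Qed.

Lemma sgn_eq0 (x : R) : sgn x = Zero -> x = 0.
Proof. by rewrite /sgn; case: ltrgt0P. Qed.

End Spectrum.

(** A zero next to the diagonal, together with the zeros of tridiagonality, completes an
    off-diagonal zero block. *)
Lemma irreducible_tridiagonal (n : nat) (P : sign_pattern n) (i j : 'I_n) :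
  irreducible P -> tridiagonal P -> j = i.+1 :> nat -> P i j <> Zero /\ P j i <> Zero.
Proof.
move=> irrP triP ij; split=> P0; apply: irrP.
(* Here the zero block is at the upper right; reversing the indices moves it to the lower left, and
   the new indices from [n - j] on are the old ones up to [i]. *)
- exists (perm (@rev_ord_inj n)), (n - j)%N; split; first by have := ltn_ord j; lia.
  move=> k l; rewrite !permE => le_k lt_l.
  have [e|ne] := boolP ((rev_ord k == i) && (rev_ord l == j)).
    by case/andP: e => /eqP-> /eqP->.
  apply: triP; move: ne le_k lt_l; rewrite -!val_eqE /=.
  by have := ltn_ord k; have := ltn_ord l; have := ltn_ord j; lia.
- exists 1%g, j; split; first by have := ltn_ord j; lia.
  move=> k l le_k lt_l; rewrite !perm1.
  have [e|ne] := boolP ((k == j) && (l == i)).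
    by case/andP: e => /eqP-> /eqP->.
  by apply: triP; move: ne le_k lt_l; rewrite -!val_eqE /=; lia.
Qed.

Section PatternEdges.
Variables (R : realType) (n : nat) (P : sign_pattern n.+1).
Hypotheses (irrP : irreducible P) (triP : tridiagonal P) (diagP : zero_diagonal P).

Lemma nonadjacent_zero (i j : 'I_n.+1) :
  j != i.+1 :> nat -> i != j.+1 :> nat -> P i j = Zero.
Proof.
move=> ij ji; have [->|ne] := eqVneq i j; first exact: diagP.
by apply: triP; move: ne; rewrite -val_eqE /=; lia.
Qed.

Definition edge_sign (k : nat) : bool :=
  0 < sign_val R (P (inord k) (inord k.+1)) * sign_val R (P (inord k.+1) (inord k)).

Lemma char_poly_class (A : 'M[R]_n.+1) :
  qualitative_class P A -> char_poly A = continuant n.+1 (edge A).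
Proof.
move=> PA; apply: char_poly_tridiagonal => i j ij ji.
by apply: sgn_eq0; rewrite PA nonadjacent_zero.
Qed.

Lemma edge_nonzero (k : nat) : (k < n)%N ->
  P (inord k) (inord k.+1) <> Zero /\ P (inord k.+1) (inord k) <> Zero.
Proof.
by move=> kn; apply: irreducible_tridiagonal => //; rewrite !inordK //; lia.
Qed.

Lemma signed_class (A : 'M[R]_n.+1) :
  qualitative_class P A -> signed edge_sign n (edge A).
Proof.
move=> PA k /edge_nonzero[]; rewrite /edge_sign /edge -!PA /sgn.
case: (ltrgt0P (A (inord k) (inord k.+1))) => // x0 _.
all: case: (ltrgt0P (A (inord k.+1) (inord k))) => // y0 _ /=.
all: rewrite ?mulN1r ?mulrN1 ?opprK ?mul1r ?oppr_gt0 ?ltr01 ?ltr10; nra.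
Qed.

(** Entries above the diagonal get absolute value 1 and those below it carry [|p k|]; the sign of
    the product is already prescribed by [P]. So the witnesses of [varying_spectrum] come from
    matrices of the class. *)
Lemma class_realization (p : nat -> R) :
  signed edge_sign n p ->
  exists2 A : 'M[R]_n.+1, qualitative_class P A & char_poly A = continuant n.+1 p.
Proof.
move=> sp; pose A : 'M[R]_n.+1 := \matrix_(i, j)
  (sign_val R (P i j) * (if (j < i)%N then `|p j| else 1)).
have PA : qualitative_class P A.
  move=> i j; rewrite mxE sgn_sign_val //; case: ifP => // lt_ji.
  rewrite normr_gt0; have := sp j (leq_trans lt_ji (leq_ord i)).
  by case: ifP => _ => [/gt_eqF->|/lt_eqF->].
exists A => //; rewrite (char_poly_class PA); apply: eq_continuant => k lt_kn.
have := sp k lt_kn; have [] := edge_nonzero lt_kn.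
rewrite /edge /edge_sign !mxE !inordK ?ltnn ?ltnSn ?ltnNge ?leqnSn //=; try lia.
case: (P _ _) => //= _; case: (P _ _) => //= _.
all: rewrite ?mulN1r ?mulrN1 ?opprK ?mul1r ?mulr1 ?oppr_gt0 ?ltr01 ?ltr10 => pk.
all: by rewrite ?(gtr0_norm pk) ?(ltr0_norm pk) ?opprK.
Qed.

End PatternEdges.

Theorem theorem3p2 (R : realType) (n : nat) (P : sign_pattern n)
    (hn : (n <= 5)%N)
    (hirr : irreducible P) (htri : tridiagonal P) (hdiag : zero_diagonal P) :
  consistent R P <-> requires_unique_inertia R P.
Proof.
(* Edges are defined for positive size only; in size 0 there is a single matrix. *)
case: n P hn hirr htri hdiag => [|n] P hn irrP triP diagP.
  split=> _; last by exists (num_real_eigenvalues (0 : 'M[R]_0)) => A _; rewrite flatmx0.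
  by move=> A B _ _; rewrite [A]flatmx0 [B]flatmx0.
have [[c cP]|[p [p' [c [c' [sp sp' rp rp' cc']]]]]]
  := @spectrum_dichotomy R n.+1 (edge_sign R P) hn.
  have specA (A : 'M[R]_n.+1) : qualitative_class P A ->
      rooted_in_squares (char_poly A) n.+1 c.
    by move=> PA; rewrite (char_poly_class triP diagP PA); apply/cP/signed_class.
  split=> _; last by exists (odd n.+1 + c.*2)%N => A /specA/spectrum_of_squares[].
  by move=> A B /specA/spectrum_of_squares[_ ->] /specA/spectrum_of_squares[_ ->].
have [A PA eA] := class_realization irrP triP diagP sp.
have [B PB eB] := class_realization irrP triP diagP sp'.
rewrite -eA in rp; rewrite -eB in rp'.
have [nA iA] := spectrum_of_squares rp; have [nB iB] := spectrum_of_squares rp'.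
(* The numbers of real eigenvalues are [odd n.+1 + c.*2] and [odd n.+1 + c'.*2], and the inertias
   begin with [c] and [c']; equality of either gives [c = c']. *)
split=> [[k kP]|uniqP]; exfalso; apply: cc'.
  by have := kP A PA; have := kP B PB; rewrite nA nB; lia.
by have := uniqP A B PA PB; rewrite iA iB => -[].
Qed.
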